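(* Let $G$ be a group and $H\le G$ a subgroup of finite index such that $[H:xHx^{-1}\cap H]\le 2$ for all $x\in G$. Then any multiset of elements of $G$ of size $[G:H]$ which generates $G$ can be Nielsen transformed to a left-right transversal of $H$ in $G$.
   Context: A left (resp. right) transversal of $H$ in $G$ is a set containing exactly one element of each left coset $gH$ (resp. each right coset $Hg$). A left-right transversal is a set which is simultaneously a left and a right transversal. Given a finite multiset $S$ of elements of $G$, a Nielsen move on $S$ is either (1) replacing some entry $g$ of $S$ by $g^{-1}$, or (2) replacing some entry $g$ of $S$ by $hg$ or $gh$, where $h$ is another entry of $S$ (a different occurrence in the multiset, possibly equal to $g$ as a group element). A Nielsen transformation is a finite sequence of Nielsen moves. *)

(* Defs.v *)
From mathcomp Require Import all_boot.
From mathcomp Require Import finmap multiset.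
From mathcomp Require Import boolp classical_sets functions cardinality.
From Stdlib Require Import Relation_Operators.

Set Implicit Arguments.
Unset Strict Implicit.
Unset Printing Implicit Defensive.

Local Open Scope mset_scope.
Local Open Scope classical_set_scope.
Local Open Scope group_scope.

(* The ambient group is a possibly infinite [groupType]; subsets of it are
   arbitrary classical sets. *)

Definition subgroup (G : groupType) (H : set G) : Prop :=
  group_closed (mem H).

Definition left_coset (G : groupType) (g : G) (H : set G) : set G :=
  [set g * h | h in H].

Definition right_coset (G : groupType) (H : set G) (g : G) : set G :=
  [set h * g | h in H].

Definition left_cosets (G : groupType) (K L : set G) : set (set G) :=
  [set left_coset k L | k in K].

Definition right_cosets (G : groupType) (K L : set G) : set (set G) :=
  [set right_coset L k | k in K].

(* [K : L] = n and [K : L] <= n, where L is a subgroup of K. As a cardinal,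
   [K : L] may be infinite, so both are stated by comparing K/L with
   {0, ..., n-1} rather than through a nat-valued index. *)
Definition index_eq (G : groupType) (K L : set G) (n : nat) : Prop :=
  (left_cosets K L #= `I_n)%card.

Definition index_le (G : groupType) (K L : set G) (n : nat) : Prop :=
  (left_cosets K L #<= `I_n)%card.

Definition conj_set (G : groupType) (x : G) (H : set G) : set G :=
  [set x * h * x^-1 | h in H].

Definition left_transversal (G : groupType) (H T : set G) : Prop :=
  forall C, left_cosets [set: G] H C -> exists! x : G, (T `&` C)%classic x.

Definition right_transversal (G : groupType) (H T : set G) : Prop :=
  forall C, right_cosets [set: G] H C -> exists! x : G, (T `&` C)%classic x.

Definition left_right_transversal (G : groupType) (H T : set G) : Prop :=
  left_transversal H T /\ right_transversal H T.

Definition generates (G : groupType) (A : set G) : Prop :=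
  smallest (@subgroup G) A = [set: G].

(* In the last two constructors, listing g and h separately from S makes h a
   different occurrence from g, even when g = h as elements of the group. *)
Inductive nielsen_move (G : groupType) : {mset G} -> {mset G} -> Prop :=
| nielsen_inv (g : G) (S : {mset G}) :
    nielsen_move (g +` S)%mset (g^-1 +` S)%mset
| nielsen_mull (g h : G) (S : {mset G}) :
    nielsen_move (g +` (h +` S))%mset (h * g +` (h +` S))%mset
| nielsen_mulr (g h : G) (S : {mset G}) :
    nielsen_move (g +` (h +` S))%mset (g * h +` (h +` S))%mset.

Definition nielsen_transformable (G : groupType) :
    {mset G} -> {mset G} -> Prop :=
  clos_refl_trans {mset G} (@nielsen_move G).

(* A multiset is a set when no element is repeated. *)
Definition mset_is_set (T : choiceType) (S : {mset T}) : Prop :=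
  forall x : T, (S x <= 1)%N.

(* Main.v *)
(* An entry r of a generating family can be replaced by any element of
   K r K or K r^-1 K, where K is generated by the other entries. If no such
   element lies in a left coset not met by the others, then K H is stable under
   r, so K H = G and r can be moved to any left coset, a contradiction. Hence
   the family can be moved to a left transversal.
   Each double coset of H has at most two left cosets, hence, H having finite
   index, as many right cosets. If r and t share a right coset but not a left
   one, then either K fixes r H and t r is a good replacement for r; or
   r = k h with k in K and h in H, and either some element of K in H moves H r
   by right multiplication, or h does. In the latter case r becomes h, and the
   entry which lay in H, now redundant, is moved to r H and corrected by h if
   needed. Every such step keeps the left transversal and meets one more right
   coset. *)

Require Import Defs.
From mathcomp Require Import all_boot.
From mathcomp Require Import finmap multiset.
From mathcomp Require Import boolp classical_sets functions cardinality.
From Stdlib Require Import Relation_Operators.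

Set Implicit Arguments.
Unset Strict Implicit.
Unset Printing Implicit Defensive.

Local Open Scope mset_scope.
Local Open Scope classical_set_scope.
Local Open Scope group_scope.

Lemma uniq_map_inj_in (T1 T2 : eqType) (f : T1 -> T2) (s : seq T1) :
  uniq (map f s) -> {in s &, injective f}.
Proof.
elim: s => //= z s IH /andP[zNs us] x y; rewrite !inE.
move=> /orP[/eqP->|xs] /orP[/eqP->|ys] // e; last exact: IH us _ _ xs ys e.
  by move: zNs; rewrite e map_f.
by move: zNs; rewrite -e map_f.
Qed.

Section Nielsen.

Variable G : groupType.
Implicit Types (A : set G) (s : seq G) (x y g h : G).

Let gsimp :=
  (@invgM G, @invgK G, @invg1 G, @mulgA G, @mulgK G, @mulgVK G, @mulgV G,
   @mulVg G, @mulg1 G, @mul1g G).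

(** * Generated subgroups *)

Lemma subgroupP A :
  subgroup A <-> A 1 /\ forall x y, A x -> A y -> A (x * y^-1).
Proof.
split=> -[A1 Adiv]; split; first by move: A1; rewrite inE.
- by move=> x y /mem_set xA /mem_set yA; have := Adiv x y xA yA; rewrite inE.
- exact/mem_set.
- by move=> x y; rewrite !inE; exact: Adiv.
Qed.

Definition span s : set G := smallest (@subgroup G) [set x | x \in s].

Lemma span_min s A : subgroup A -> (forall x, x \in s -> A x) -> span s `<=` A.
Proof. by move=> sgA sA; apply: smallest_sub. Qed.

Lemma span_subgroup s : subgroup (span s).
Proof.
apply/subgroupP; split; first by move=> A [/subgroupP[]].
move=> x y sx sy A [sgA sA]; have /subgroupP[_] := sgA; apply.
  by apply: sx; split.
by apply: sy; split.
Qed.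

Lemma mem_span s x : x \in s -> span s x.
Proof. by move=> xs A [_]; apply. Qed.

Lemma span1 s : span s 1.
Proof. by have /subgroupP[] := span_subgroup s. Qed.

Lemma spanV s x : span s x -> span s x^-1.
Proof.
have /subgroupP[s1 sD] := span_subgroup s.
by move=> sx; rewrite -(mul1g x^-1); exact: sD.
Qed.

Lemma spanM s x y : span s x -> span s y -> span s (x * y).
Proof.
have /subgroupP[s1 sD] := span_subgroup s.
by move=> sx sy; rewrite -(invgK y); apply: sD => //; exact: spanV.
Qed.

Definition spanning s := forall g, span s g.

Lemma spanning_sub s1 s2 :
  (forall x, x \in s1 -> span s2 x) -> spanning s1 -> spanning s2.
Proof.
by move=> s12 sp1 g; apply: span_min (sp1 g) => //; exact: span_subgroup.
Qed.

(** * Nielsen moves on sequences of generators *)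

Definition seq_nielsen s1 s2 :=
  nielsen_transformable (seq_mset s1) (seq_mset s2).

Lemma seq_nielsen_trans s1 s2 s3 :
  seq_nielsen s1 s2 -> seq_nielsen s2 s3 -> seq_nielsen s1 s3.
Proof. exact: rt_trans. Qed.

Lemma perm_seq_nielsen s1 s2 : perm_eq s1 s2 -> seq_nielsen s1 s2.
Proof. by move/eq_seq_msetP => e; rewrite /seq_nielsen e; exact: rt_refl. Qed.

Lemma mem_seq_mset (s : seq G) : seq_mset s =i s.
Proof. by move=> x; apply: perm_mem; exact: perm_eq_seq_mset. Qed.

(** The entry replaced by a move is recovered from the new entries, so the old generators stay in
    the new span. *)
Lemma seq_nielsen_spanning s1 s2 :
  seq_nielsen s1 s2 -> spanning s1 -> spanning s2.
Proof.
suff move_span (S T : {mset G}) :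
    nielsen_move S T -> spanning S -> spanning T.
  have tr_span (S T : {mset G}) :
      nielsen_transformable S T -> spanning S -> spanning T.
    by elim=> [U V /move_span||U V W _ UV _ VW /UV/VW].
  move=> /tr_span tr sp1.
  apply: (@spanning_sub (seq_mset s2)).
    by move=> x; rewrite mem_seq_mset => /mem_span.
  apply: tr; apply: spanning_sub sp1 => x xs1; apply: mem_span.
  by rewrite mem_seq_mset.
have in2 (u v : G) (U : {mset G}) y : y \in v +` U -> span (u +` (v +` U)) y.
  by move=> yU; apply: mem_span; rewrite in_mset1D yU orbT.
have in1 (u : G) (U : {mset G}) : span (u +` U) u.
  by apply: mem_span; rewrite in_mset1D eqxx.
case=> {S T} [g S|g h S|g h S]; apply: spanning_sub => x;
  rewrite in_mset1D => /orP[/eqP->|xS]; try exact: in2.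
- by have := spanV (in1 g^-1 S); rewrite invgK.
- by apply: mem_span; rewrite in_mset1D xS orbT.
- rewrite -[X in span _ X](mulKg h); apply: spanM => //; apply: spanV; apply: in2.
  by rewrite in_mset1D eqxx.
- rewrite -[X in span _ X](mulgK h); apply: spanM => //; apply: spanV; apply: in2.
  by rewrite in_mset1D eqxx.
Qed.

Lemma nielsenV x s : seq_nielsen (x :: s) (x^-1 :: s).
Proof. by rewrite /seq_nielsen !mset_cons; apply: rt_step; constructor. Qed.

Lemma nielsenMl x k s : span s k -> seq_nielsen (x :: s) (k * x :: s).
Proof.
move=> sk; move: x.
(* Asking for [g] and [g^-1] at every [x] makes [A] a subgroup; it then suffices to treat the
   entries of [s]. *)
pose A := [set g | forall x, seq_nielsen (x :: s) (g * x :: s)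
                          /\ seq_nielsen (x :: s) (g^-1 * x :: s)].
suff : A k by move=> Ak x; have [] := Ak x.
apply: span_min sk => [|h hs].
  apply/subgroupP; split => [x|u v Au Av x].
    by rewrite invg1 mul1g; split; exact: rt_refl.
  rewrite invgM invgK -!mulgA; split.
    by apply: seq_nielsen_trans (Av x).2 _; have [] := Au (v^-1 * x).
  by apply: seq_nielsen_trans (Au x).2 _; have [] := Av (u^-1 * x).
have hsE : perm_eq s (h :: rem h s) by exact: perm_to_rem.
have sE y : seq_mset (y :: s) = y +` (h +` seq_mset (rem h s)).
  by rewrite mset_cons -(mset_cons h); have /eq_seq_msetP -> := hsE.
move=> x; split.
  by rewrite /seq_nielsen !sE; apply: rt_step; constructor.
(* Division by an entry: invert, multiply on the other side, invert back. *)
have -> : h^-1 * x = (x^-1 * h)^-1 by rewrite invgM invgK.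
apply: seq_nielsen_trans (nielsenV _ _) _.
apply: seq_nielsen_trans _ (nielsenV _ _).
by rewrite /seq_nielsen !sE; apply: rt_step; constructor.
Qed.

Lemma nielsenMr x k s : span s k -> seq_nielsen (x :: s) (x * k :: s).
Proof.
move=> sk; have -> : x * k = (k^-1 * x^-1)^-1 by rewrite invgM !invgK.
apply: seq_nielsen_trans (nielsenV _ _) _.
apply: seq_nielsen_trans _ (nielsenV _ _).
by apply: nielsenMl; exact: spanV.
Qed.

(** * Labels for left and right cosets *)

Section Cosets.

Variables (H : set G) (n : nat) (c : G -> 'I_n).
Hypothesis cP : forall x y, c x = c y <-> H (x^-1 * y).
Hypothesis c_surj : forall i, exists x, c x = i.

(** Inversion carries [H x] to [x^-1 H], so the same labels serve for right cosets. *)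
Let c' x := c x^-1.

Lemma c'P x y : c' x = c' y <-> H (x * y^-1).
Proof. by rewrite /c' cP invgK. Qed.

Lemma cMl g x y : c x = c y -> c (g * x) = c (g * y).
Proof. by move=> /cP xy; apply/cP; rewrite !gsimp. Qed.

Lemma c1P h : c h = c 1 <-> H h.
Proof.
by split=> [/esym/cP|Hh]; last (symmetry; apply/cP); rewrite invg1 mul1g.
Qed.

Lemma cMr x h : H h -> c (x * h) = c x.
Proof. by move=> Hh; symmetry; apply/cP; rewrite !gsimp. Qed.

Lemma subgroup_of_index : H 1 /\ (forall h, H h -> H h^-1) /\
  forall h k, H h -> H k -> H (h * k).
Proof.
split; first exact/c1P.
split=> [h /c1P h1|h k /c1P h1 Hk]; last by apply/c1P; rewrite cMr.
by apply/c1P; have := cMl h^-1 h1; rewrite !gsimp => ->.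
Qed.

Let HV := subgroup_of_index.2.1.
Let HM := subgroup_of_index.2.2.

Lemma c'Mr g x y : c' x = c' y -> c' (x * g) = c' (y * g).
Proof. by rewrite !c'P !gsimp. Qed.

Lemma c'Ml x h : H h -> c' (h * x) = c' x.
Proof. by move=> Hh; apply/c'P; rewrite !gsimp. Qed.

Lemma c_eq1V x : c x = c 1 -> c' x = c' 1.
Proof. by move=> /c1P Hx; apply/c'P; rewrite !gsimp. Qed.

(** * Reaching a left transversal *)

Lemma reach_uncovered_left x s : spanning (x :: s) -> (exists i, i \notin map c s) ->
  exists y, seq_nielsen (x :: s) (y :: s) /\ c y \notin map c s.
Proof.
move=> sp [i iNs]; apply: contrapT => stuck.
have {}stuck y : seq_nielsen (x :: s) (y :: s) -> c y \in map c s.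
  by move=> xy; apply/negPn/negP => yNs; apply: stuck; exists y.
pose KH := [set g | exists2 k, span s k & c g = c k].
have covKH g : c g \in map c s -> KH g.
  by case/mapP => k ks gk; exists k => //; exact: mem_span.
have KHall g : KH g.
  pose A := [set u | forall g, KH g -> KH (u * g) /\ KH (u^-1 * g)].
  suff Ag : A g.
    have [|] := Ag 1; last by rewrite mulg1.
    by exists 1 => //; exact: span1.
  apply: span_min (sp g) => [|u].
    apply/subgroupP; split=> [u KHu|u v Au Av w KHw].
      by rewrite invg1 mul1g.
    rewrite invgM invgK -!mulgA; split.
      by have [] := Au _ (Av _ KHw).2.
    by have [] := Av _ (Au _ KHw).2.
  rewrite inE => /orP[/eqP->|us] w [k sk wk].
    (* As [w] lies in [k H], the coset of [x * w] is that of [x * k], a value reachable from [x],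
       hence covered. *)
    split; apply: covKH; rewrite (cMl _ wk); apply: stuck.
      exact: nielsenMr.
    by apply: seq_nielsen_trans (nielsenV _ _) _; exact: nielsenMr.
  split; [exists (u * k)|exists (u^-1 * k)]; try exact: cMl.
    by apply: spanM => //; exact: mem_span.
  by apply: spanM => //; apply: spanV; exact: mem_span.
(* With [k] in the missed coset and [l] in that of [x], the reachable entry [k * l^-1 * x] lies in
   the missed coset. *)
have [z zi] := c_surj i; have [k sk zk] := KHall z; have [l sl xl] := KHall x.
move: iNs; rewrite -zi zk.
have -> : c k = c (k * l^-1 * x) by rewrite (cMl _ xl) mulgVK.
by rewrite stuck//; apply: nielsenMl; apply: spanM => //; exact: spanV.
Qed.

Lemma not_uniq_perm (T : eqType) (f : G -> T) s : ~~ uniq (map f s) ->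
  exists x s1, perm_eq s (x :: s1) /\ f x \in map f s1.
Proof.
elim: s => //= x s IH; rewrite negb_and negbK => /orP[fx|/IH[y [s1 [ss1 fy]]]].
  by exists x, s.
exists y, (x :: s1); split; last by rewrite /= inE fy orbT.
rewrite -[y :: _]/([:: y] ++ [:: x] ++ s1) perm_sym perm_catCA /=.
by rewrite perm_cons perm_sym.
Qed.

Definition covered f s : {set 'I_n} := [set i in map f s].

(** Induction on the number of missed cosets: dropping an entry with a repeated label loses no
    coset, and the [n - 1] others leave one to reach. *)
Lemma cover_left s : size s = n -> spanning s ->
  exists s', [/\ seq_nielsen s s', size s' = n & uniq (map c s')].
Proof.
have [m] := ubnP (n - #|covered c s|); elim: m s => // m IH s ltm ssz sp.
have [us|/not_uniq_perm[x [s1 [ss1 xs1]]]] := boolP (uniq (map c s)).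
  by exists s; split=> //; exact: rt_refl.
have s1sz : (size s1).+1 = n by rewrite -ssz (perm_size ss1).
have sp1 : spanning (x :: s1).
  exact: seq_nielsen_spanning (perm_seq_nielsen ss1) sp.
have [|y [xy yNs1]] := reach_uncovered_left sp1.
  apply: contrapT => allc.
  have : #|'I_n| <= size (map c s1).
    rewrite cardE; apply: uniq_leq_size (enum_uniq _) _ => i _.
    by apply/negPn/negP => iN; apply: allc; exists i.
  by rewrite card_ord size_map -s1sz ltnn.
have [||s' [ys' s'sz s'u]] := IH (y :: s1) _ s1sz.
- have covlt : #|covered c s| < #|covered c (y :: s1)|.
    apply: proper_card; apply/properP; split.
      apply/fintype.subsetP => i; rewrite !inE (perm_mem (perm_map c ss1)) inE.
      by move=> /orP[/eqP->|->]; rewrite ?xs1 orbT.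
    exists (c y); rewrite !inE ?eqxx//.
    rewrite (perm_mem (perm_map c ss1)) inE (negbTE yNs1) orbF.
    by apply: contraNneq yNs1 => ->.
  rewrite ltnS in ltm; apply: leq_trans ltm; apply: ltn_sub2l (covlt).
  apply: leq_trans covlt _.
  by rewrite -[X in _ <= X]card_ord; exact: max_card.
- exact: seq_nielsen_spanning xy sp1.
exists s'; split=> //.
apply: seq_nielsen_trans ys'; apply: seq_nielsen_trans xy.
exact: perm_seq_nielsen.
Qed.

(** * Gaining right cosets while keeping the left transversal *)

Hypothesis two_cosets : forall r a b, H a -> H b ->
  [\/ c r = c (a * r), c r = c (b * r) | c (a * r) = c (b * r)].

(** All of [r], [t], [x] lie in the double coset [H r H], whose only left cosets are then [r H] and
    [t H]. *)
Lemma double_coset_left r t x a : c r <> c t -> c' t = c' r ->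
  H a -> c' x = c' (r * a) -> c x = c r \/ c x = c t.
Proof.
move=> rt /c'P Htr Ha /c'P Hx.
have tE : t = t * r^-1 * r by rewrite mulgVK.
have xE : c x = c (x * (r * a)^-1 * r).
  by rewrite -[LHS](cMr _ (HV Ha)) !gsimp.
by rewrite xE; case: (two_cosets r Htr Hx) => [||]; rewrite -?tE; [|left|right].
Qed.

(* If [r H r^-1] were contained in [H], then [g H |-> g r^-1 H] would be a
   well-defined surjection of the finite set [G/H], hence injective, forcing
   [r H r^-1 = H] and so [t H = r H]. *)
Lemma exists_other_right r t : c r <> c t -> c' t = c' r ->
  exists2 a, H a & c' (r * a) <> c' r.
Proof.
move=> rt /c'P Htr; apply: contrapT => noa.
have conjH a : H a -> H (r * a * r^-1).
  move=> Ha; apply/c'P; apply: contrapT => ?; by apply: noa; exists a.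
have [z zK] := choice c_surj.
pose f i := c (z i * r^-1).
have fE g : f (c g) = c (g * r^-1).
  have /cP/conjH Hzg := zK (c g).
  by apply/cP; rewrite !gsimp in Hzg *.
have gK : cancel (fun i => c (z i * r)) f.
  by move=> i; rewrite fE mulgK zK.
apply: rt; apply/cP; apply/c1P; apply: (can_inj (canF_sym gK)).
have tE : t * r^-1 = r * (r^-1 * t) * r^-1 by rewrite mulVKg.
by rewrite !fE mul1g -mulgA cMr.
Qed.

Lemma uniq_full (l : seq 'I_n) : uniq l -> size l = n -> forall i, i \in l.
Proof.
move=> ul ln i; have [||_ ->] := uniq_min_size ul (s2 := enum 'I_n).
- by move=> j _; rewrite mem_enum.
- by rewrite -cardE card_ord ln.
by rewrite mem_enum.
Qed.

(** The rest may change to [s2], because in the last case an entry of [H] is exchanged too. *)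
Lemma reach_new_right r t s :
  size (r :: s) = n -> spanning (r :: s) -> uniq (map c (r :: s)) ->
  t \in s -> c' t = c' r ->
  exists y s2, [/\ seq_nielsen (r :: s) (y :: s2), c y = c r /\ c' y <> c' r,
    perm_eq (map c s2) (map c s) & {subset map c' s <= map c' s2}].
Proof.
move=> sz sp us ts c'tr.
have full : forall i, i \in map c (r :: s) by apply: uniq_full; rewrite ?size_map.
have cov g : c g = c r \/ exists2 u, u \in s & c g = c u.
  have := full (c g); rewrite inE => /orP[/eqP|/mapP]; [by left|by right].
have /andP[rNs us'] : (c r \notin map c s) && uniq (map c s) by [].
have rt : c r <> c t by move=> e; move: rNs; rewrite e map_f.
have NHt : ~ H t.
  move=> Ht; apply: rt; have c't1 : c' t = c' 1 by rewrite -(mulg1 t) c'Ml.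
  have Hr : H r by move/c'P: (etrans (esym c'tr) c't1); rewrite invg1 mulg1.
  by rewrite (c1P r).2 // (c1P t).2.
have NHr : ~ H r.
  move=> Hr; apply: NHt; have c'r1 : c' r = c' 1 by rewrite -(mulg1 r) c'Ml.
  by move/c'P: (etrans c'tr c'r1); rewrite invg1 mulg1.
(* If [span s] misses [r H], then [t * r] stays in [r H]: sharing a left coset with [u] in [s] would
   put [t^-1 * u] in [r H]. *)
have [[k sk ckr]|noK] := pselect (exists2 k, span s k & c k = c r); last first.
  exists (t * r), s; split=> //; first by apply: nielsenMl; exact: mem_span.
  split; last by move=> /c'P; rewrite mulgK.
  have [//|[u us1 tru]] := cov (t * r); exfalso; apply: noK.
  exists (t^-1 * u); last by rewrite -(cMl _ tru) mulKg.
  by apply: spanM; [apply: spanV|]; exact: mem_span.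
have KH g : exists2 k', span s k' & c g = c k'.
  have [->|[u us1 ->]] := cov g; first by exists k.
  by exists u => //; exact: mem_span.
have [[k0 [sk0 Hk0 rk0]]|noswap] := pselect
    (exists k0, [/\ span s k0, H k0 & c' (r * k0) <> c' r]).
  exists (r * k0), s; split=> //; first exact: nielsenMr.
  by split=> //; exact: cMr.
have {}noswap k0 : span s k0 -> H k0 -> c' (r * k0) = c' r.
  by move=> sk0 Hk0; apply: contrapT => ?; apply: noswap; exists k0.
pose h := k^-1 * r.
have Hh : H h by apply/cP.
(* Otherwise [k] lies in [H r]. Choose a right coset [H r a] other than [H r] and [k1^-1] in it,
   with [k1] in [span s]. Then [k1^-1] is in [k H] or [t H], so it is [k] or [t] times an element of
   [H] in [span s], and [noswap] puts it back in [H r]. *)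
have rh : c' (r * h) <> c' r.
  move=> /c'P Hrh.
  have c'k : c' k = c' r.
    by apply/c'P; move: (HV Hrh); rewrite /h !gsimp.
  have [a Ha ra] := exists_other_right rt c'tr.
  have [k1 /spanV sk1 k1E] := KH (r * a)^-1.
  have {}k1E : c' k1^-1 = c' (r * a) by rewrite /c' invgK.
  have [e|e] := double_coset_left rt c'tr Ha k1E.
    apply: ra; rewrite -k1E -(mulVKg k k1^-1) (c'Mr _ c'k); apply: noswap.
      by apply: spanM => //; exact: spanV.
    by apply/cP; rewrite ckr.
  apply: ra; rewrite -k1E -(mulVKg t k1^-1) (c'Mr _ c'tr); apply: noswap.
    by apply: spanM => //; apply: spanV; exact: mem_span.
  by apply/cP.
have rhs : seq_nielsen (r :: s) (h :: s) by apply: nielsenMl; exact: spanV.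
(* The entry [s0] lies in [H]; [h] takes over its left and right coset, which frees [s0] to move to
   [r H]. *)
have [e|[s0 s0s cs0]] := cov 1; first by case: NHr; apply/c1P.
have ss0 := perm_to_rem s0s; set s3 := rem s0 s in ss0.
have rs0 : seq_nielsen (r :: s) (s0 :: h :: s3).
  apply: seq_nielsen_trans rhs _; apply: perm_seq_nielsen.
  rewrite perm_sym -[_ :: _]/([:: s0] ++ [:: h] ++ s3) perm_catCA /=.
  by rewrite perm_cons perm_sym.
have chs : perm_eq (map c (h :: s3)) (map c s).
  by rewrite perm_sym (permPl (perm_map c ss0)) /= -cs0 (c1P h).2.
have c'hs : {subset map c' s <= map c' (h :: s3)}.
  move=> i; rewrite (perm_mem (perm_map c' ss0)) /=.
  by rewrite (c_eq1V (esym cs0)) (c_eq1V (x := h)) //; apply/c1P.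
have [|y [ys yN]] := reach_uncovered_left (seq_nielsen_spanning rs0 sp).
  by exists (c r); rewrite (perm_mem chs).
have cy : c y = c r.
  have [//|[u us1 yu]] := cov y.
  by move: yN; rewrite (perm_mem chs) yu map_f.
have [c'y|c'y] := pselect (c' y = c' r); last first.
  by exists y, (h :: s3); split=> //; apply: seq_nielsen_trans ys.
(* Here [H y = H r], so right multiplication by [h] leaves [H r] by [rh], and it preserves [y H]. *)
exists (y * h), (h :: s3); split=> //; last by rewrite cMr // (c'Mr _ c'y).
apply: seq_nielsen_trans rs0 _; apply: seq_nielsen_trans ys _.
by apply: nielsenMr; apply: mem_span; rewrite inE eqxx.
Qed.

Lemma cover_right s : size s = n -> spanning s -> uniq (map c s) ->
  exists s', [/\ seq_nielsen s s', size s' = n, uniq (map c s')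
                & uniq (map c' s')].
Proof.
have [m] := ubnP (n - #|covered c' s|); elim: m s => // m IH s ltm ssz sp us.
have [us'|/not_uniq_perm[r [s1 [ss1 /mapP[t ts1 c'rt]]]]] :=
  boolP (uniq (map c' s)).
  by exists s; split=> //; exact: rt_refl.
have s1sz : size (r :: s1) = n by rewrite -(perm_size ss1).
have us1 : uniq (map c (r :: s1)) by rewrite -(perm_uniq (perm_map c ss1)).
have sp1 : spanning (r :: s1).
  exact: seq_nielsen_spanning (perm_seq_nielsen ss1) sp.
have [y [s2 [rys [cy c'y] cs12 c's12]]] := reach_new_right s1sz sp1 us1 ts1 (esym c'rt).
have /andP[rNs1 us1'] : (c r \notin map c s1) && uniq (map c s1) by [].
have rt : c r <> c t by move=> e; move: rNs1; rewrite e map_f.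
(* An entry [u] of [s1] in [H y] would lie in [r H] or [t H]. The first is excluded by the left
   labels, and the second forces [u = t], which lies in [H r], unlike [y]. *)
have yNs : c' y \notin map c' (r :: s1).
  rewrite inE negb_or; apply/andP; split; first exact/eqP.
  apply/negP => /mapP[u us2 /esym yu].
  have Hry : H (r^-1 * y) by apply/cP.
  have yE : c' u = c' (r * (r^-1 * y)) by rewrite mulVKg.
  have [e|e] := double_coset_left rt (esym c'rt) Hry yE.
    by move: rNs1; rewrite -e map_f.
  have ut : u = t by apply: (uniq_map_inj_in us1').
  by apply: c'y; rewrite -yu ut.
have [||||s' [ys' s'sz s'u s'u']] := IH (y :: s2).
- have covlt : #|covered c' s| < #|covered c' (y :: s2)|.
    apply: proper_card; apply/properP; split.
      apply/fintype.subsetP => i; rewrite !inE (perm_mem (perm_map c' ss1)) inE.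
      by rewrite c'rt => /orP[/eqP->|/c's12->]; rewrite ?(c's12 _ (map_f _ ts1)) orbT.
    exists (c' y); first by rewrite !inE eqxx.
    by rewrite inE (perm_mem (perm_map c' ss1)).
  rewrite ltnS in ltm; apply: leq_trans ltm; apply: ltn_sub2l (covlt).
  apply: leq_trans covlt _.
  by rewrite -[X in _ <= X]card_ord; exact: max_card.
- by have := perm_size cs12; rewrite !size_map -s1sz /= => ->.
- exact: seq_nielsen_spanning rys sp1.
- by rewrite /= cy (perm_mem cs12) (perm_uniq cs12).
exists s'; split=> //.
apply: seq_nielsen_trans ys'; apply: seq_nielsen_trans rys.
exact: perm_seq_nielsen.
Qed.

End Cosets.
End Nielsen.

(** * From cosets and indices to labels *)

Lemma left_coset_eq (G : groupType) (H : set G) (x y : G) : subgroup H ->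
  left_coset x H = left_coset y H <-> H (x^-1 * y).
Proof.
move=> /subgroupP[H1 HD].
have HV h : H h -> H h^-1 by move=> Hh; rewrite -(mul1g h^-1); exact: HD.
have HM h k : H h -> H k -> H (h * k).
  by move=> Hh Hk; rewrite -(invgK k); apply: HD => //; exact: HV.
split=> [e|Hxy].
  have : left_coset x H y by rewrite e; exists 1; rewrite ?mulg1.
  by case=> h Hh <-; rewrite mulKg.
apply/seteqP; split=> _ [h Hh <-].
  exists ((x^-1 * y)^-1 * h); first by apply: HM => //; exact: HV.
  by rewrite invgM invgK mulgA mulVKg.
by exists (x^-1 * y * h); [exact: HM|rewrite mulgA mulVKg].
Qed.

(* Each right coset [H g] is recorded by the inverse left coset [g^-1 H]. *)
Lemma right_coset_mem (G : groupType) (H : set G) (g x : G) : subgroup H ->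
  right_coset H g x <-> left_coset x^-1 H = left_coset g^-1 H.
Proof.
move=> sgH; rewrite left_coset_eq // invgK; split.
  by case=> h Hh <-; rewrite mulgK.
by move=> Hxg; exists (x * g^-1); rewrite ?mulgVK.
Qed.

Lemma left_coset_mem (G : groupType) (H : set G) (g x : G) : subgroup H ->
  left_coset g H x <-> left_coset g H = left_coset x H.
Proof.
move=> sgH; rewrite left_coset_eq //; split.
  by case=> h Hh <-; rewrite mulKg.
by move=> Hxg; exists (g^-1 * x); rewrite ?mulVKg.
Qed.

Lemma index_eq_label (G : groupType) (H : set G) (n : nat) : subgroup H ->
  index_eq [set: G] H n ->
  exists2 c : G -> 'I_n, (forall x y, c x = c y <-> H (x^-1 * y))
                       & (forall i, exists x, c x = i).
Proof.
move=> sgH /card_set_bijP[f [fS fI fO]].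
have ltf x : f (left_coset x H) < n by apply: fS; exists x.
exists (fun x => Ordinal (ltf x)) => [x y|i].
  rewrite -left_coset_eq //; split=> [[]|e]; last by apply: val_inj; rewrite /= e.
  by apply: fI; apply/mem_set; [exists x|exists y].
have [C [x _ <-] fx] := fO i (ltn_ord i).
by exists x; apply: val_inj.
Qed.

Lemma index_le2_pigeonhole (G : groupType) (K L : set G) (x y z : G) :
  subgroup L -> index_le K L 2 -> K x -> K y -> K z ->
  [\/ L (x^-1 * y), L (x^-1 * z) | L (y^-1 * z)].
Proof.
move=> sgL /pcard_leP[f] Kx Ky Kz.
have f2 u : K u -> f (left_coset u L) < 2.
  by move=> Ku; apply: (@funS _ _ _ _ f); exists u.
have fI u v : K u -> K v -> f (left_coset u L) = f (left_coset v L) ->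
    L (u^-1 * v).
  move=> Ku Kv e; apply/(left_coset_eq _ _ sgL).
  by apply: (@inj _ _ _ f) e; apply/mem_set; [exists u|exists v].
have := fI y z Ky Kz; have := fI x z Kx Kz; have := fI x y Kx Ky.
move: (f2 x Kx) (f2 y Ky) (f2 z Kz).
by case: (f (left_coset x L)) => [|[|//]]; case: (f (left_coset y L)) => [|[|//]];
  case: (f (left_coset z L)) => [|[|//]] _ _ _ xy xz yz;
  [apply: Or31; exact: xy|apply: Or31; exact: xy|apply: Or32; exact: xz
  |apply: Or33; exact: yz|apply: Or33; exact: yz|apply: Or32; exact: xz
  |apply: Or31; exact: xy|apply: Or31; exact: xy].
Qed.

Lemma subgroup_conjI (G : groupType) (H : set G) (r : G) : subgroup H ->
  subgroup (conj_set r H `&` H)%classic.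
Proof.
move=> /subgroupP[H1 HD]; apply/subgroupP; split.
  by split=> //; exists 1; rewrite ?mulg1 ?mulgV.
move=> _ _ [[h Hh <-] Hrh] [[k Hk <-] Hrk]; split; last exact: HD.
by exists (h * k^-1); [exact: HD|rewrite !invgM invgK !mulgA mulgVK].
Qed.

Theorem proposition6p36 (G : groupType) (H : set G) (n : nat)
    (subgroupH : subgroup H)
    (indexH : index_eq [set: G] H n)
    (index_conj : forall x : G, index_le H (conj_set x H `&` H)%classic 2)
    (S : {mset G})
    (sizeS : size S = n)
    (genS : generates [set` S]) :
  exists T : {mset G},
    [/\ nielsen_transformable S T,
        mset_is_set T
      & left_right_transversal H [set` T]].
Proof.
have [c cP c_surj] := index_eq_label subgroupH indexH.
have two r a b : H a -> H b ->
    [\/ c r = c (a * r), c r = c (b * r) | c (a * r) = c (b * r)].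
  have [H1 _] := (subgroupP H).1 subgroupH => Ha Hb.
  (* The cosets [u r H] and [v r H] agree once [u^-1 * v] lies in [r H r^-1], so the index bound
     limits the left cosets in [H r H] to two. *)
  have conjP u v : (conj_set r H `&` H)%classic (u^-1 * v) ->
      c (u * r) = c (v * r).
    case=> -[h Hh e] _; apply/cP.
    by rewrite invgM -mulgA (mulgA u^-1) -e mulgVK mulKg.
  have [/conjP|/conjP|/conjP] := index_le2_pigeonhole
    (subgroup_conjI r subgroupH) (index_conj r) H1 Ha Hb;
    rewrite ?mul1g => e; [exact: Or31|exact: Or32|exact: Or33].
have spS : spanning S.
  by move=> g; rewrite /span; have /seteqP[_] := genS; exact.
have [s1 [Ss1 s1sz s1u]] := cover_left cP c_surj sizeS spS.
have sp1 := seq_nielsen_spanning Ss1 spS.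
have [s2 [s12 s2sz s2u s2u']] := cover_right cP c_surj two s1sz sp1 s1u.
have cE x y : c x = c y <-> left_coset x H = left_coset y H.
  by rewrite cP left_coset_eq.
exists (seq_mset s2); split.
- by rewrite -[S]seq_mset_id; exact: seq_nielsen_trans Ss1 s12.
- by move=> x; rewrite mset_seqE count_uniq_mem ?(map_uniq s2u) // leq_b1.
split=> _ [g _ <-].
  (* The [n] distinct labels exhaust the [n] cosets; distinctness then gives uniqueness. *)
  have /mapP[x xs2 gx] : c g \in map c s2.
    by apply: uniq_full; rewrite ?size_map.
  exists x; split.
    split; first by rewrite /= mem_seq_mset.
    exact/left_coset_mem/cE.
  move=> y [/=]; rewrite mem_seq_mset => ys2 /(left_coset_mem _ _ subgroupH)/cE.
  by rewrite gx => xy; apply: (uniq_map_inj_in s2u).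
have /mapP[x xs2 gx] : c g^-1 \in map (fun x => c x^-1) s2.
  by apply: uniq_full; rewrite ?size_map.
exists x; split.
  split; first by rewrite /= mem_seq_mset.
  exact/right_coset_mem/cE.
move=> y [/=]; rewrite mem_seq_mset => ys2 /(right_coset_mem _ _ subgroupH)/cE.
by rewrite gx => yx; apply: (uniq_map_inj_in s2u').
Qed.
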